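(* Let $P(t)$, $t\in[0,D]$, be the optimal policy and $T(t)$ the resulting temperature. If there is a jump in $P(t)$, it occurs only at an energy arrival instant $s_k$ ($1\le k\le N$), when the battery is empty, i.e. $\int_0^{s_k}P(\tau)\,d\tau=\sum_{i=0}^{k-1}E_i$, and the temperature is strictly below $T_c$, i.e. $T(s_k)<T_c$.
   Context: Fix a deadline $D>0$, constants $a,b>0$, an environment temperature $T_e$ and a critical temperature $T_c>T_e$; set $T_\delta=T_c-T_e$. Energy amounts $E_0,E_1,\dots,E_N>0$ become available at times $0=s_0<s_1<\dots<s_N<D$ respectively, and $s_{N+1}=D$. The instants $s_1,\dots,s_N$ are the energy arrival (harvesting) instants. For $t\in(0,D]$ let $h(t)=\max\{k: s_k<t\}$. A power policy is a measurable function $P:[0,D]\to[0,\infty)$. The resulting temperature $T(t)$ solves $\frac{d}{dt}T(t)=aP(t)-b(T(t)-T_e)$, $T(0)=T_e$, i.e. $T(t)=T_e+e^{-bt}\int_0^t ae^{b\tau}P(\tau)\,d\tau$. The optimal policy is the maximizer of $\int_0^D\frac12\log_2(1+P(\tau))\,d\tau$ over power policies satisfying the temperature constraint $T(t)\le T_c$ for all $t\in[0,D]$ (equivalently $\int_0^t ae^{b\tau}P(\tau)\,d\tau\le T_\delta e^{bt}$ for all $t$) and the energy causality constraint $\int_0^tP(\tau)\,d\tau\le\sum_{i=0}^{h(t)}E_i$ for all $t\in(0,D]$. It is unique almost everywhere; pointwise statements about it are understood after modification on a null set. *)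

(* Defs.v *)
From HB Require Import structures.
From mathcomp Require Import all_boot all_order all_algebra.
From mathcomp Require Import all_classical all_reals all_analysis.
Set Implicit Arguments.
Unset Strict Implicit.
Unset Printing Implicit Defensive.
Import Order.TTheory GRing.Theory Num.Theory.
Import numFieldNormedType.Exports.
Local Open Scope classical_set_scope.
Local Open Scope ring_scope.

Section EnergyHarvesting.
Context {R : realType}.
Implicit Types (D a b Te Tc t : R) (N : nat) (s E : nat -> R) (P Q : R -> R).

Local Notation mu := (@lebesgue_measure R).

(* Only s 0, ..., s N.+1 are constrained. *)
Definition arrival_times D N s : Prop :=
  [/\ s 0%N = 0, s N.+1 = D & forall k, (k <= N)%N -> s k < s k.+1].

(* Policies live on [0, D]; their values elsewhere are irrelevant. *)
Definition is_policy D P : Prop :=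
  measurable_fun `[0, D] P /\ forall t, t \in `[0, D] -> 0 <= P t.

(* Integrals are extended-real valued, so a policy of infinite energy violates
   the constraints below instead of being assigned a default value. *)
Definition consumed P t : \bar R := (\int[mu]_(x in `[0%R, t]) (P x)%:E)%E.

Definition temperature a b Te P t : \bar R :=
  (Te%:E + (expR (- (b * t)))%:E *
     \int[mu]_(x in `[0%R, t]) (a * expR (b * x) * P x)%:E)%E.

Definition last_arrival N s t : nat :=
  (\max_(k < N.+1 | (s k < t)%R) (k : nat))%N.

Definition feasible D a b Te Tc N s E P : Prop :=
  [/\ is_policy D P,
      forall t, t \in `[0, D] -> (temperature a b Te P t <= Tc%:E)%E
    & forall t, t \in `]0, D] ->
        (consumed P t <= (\sum_(i < (last_arrival N s t).+1) E i)%:E)%E].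

Definition throughput D P : \bar R :=
  (\int[mu]_(x in `[0%R, D]) (2^-1 * (ln (1 + P x) / ln 2))%:E)%E.

Definition optimal D a b Te Tc N s E P : Prop :=
  feasible D a b Te Tc N s E P /\
  forall P', feasible D a b Te Tc N s E P' ->
    (throughput D P' <= throughput D P)%E.

Definition version D P Q : Prop :=
  is_policy D Q /\ {ae mu, forall x, x \in `[0, D] -> Q x = P x}.

(* Every discontinuity relative to [0, D] counts as a jump. Asking in addition
   for distinct one-sided limits would make absence of jumps trivial to achieve
   by altering a function on a dense null set. *)
Definition jump_at D Q t : Prop :=
  t \in `[0, D] /\ ~ (Q x @[x --> within `[0, D] (nbhs t)] --> Q t).

End EnergyHarvesting.

(* Main.v *)
(* Two exchange arguments replace Lagrange multipliers. Postponing power with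
   weight e^{-bx} keeps the heat \int a e^{bx} P unchanged in the end and lowers
   it, as well as the consumed energy, in between; such an exchange is therefore
   always feasible, and optimality forces G(x) = e^{bx} (1 + P(x)) to be
   nondecreasing on a set of full measure. Hence P has a version with one-sided
   limits and only upward jumps. Conversely, advancing power from just after to
   just before a time t is feasible when the temperature is below T_c around t
   and no arrival with an empty battery is crossed, and it increases the
   throughput at an upward jump. If the temperature equals T_c at t, the heat
   balance on both sides gives P(t-) >= b T_delta / a >= P(t+), so there is no
   upward jump either. *)
Require Import Defs.
From HB Require Import structures.
From mathcomp Require Import all_boot all_order all_algebra.
From mathcomp Require Import all_classical all_reals all_analysis.
From mathcomp Require Import measurable_realfun lra ring.
Import Order.TTheory GRing.Theory Num.Theory.
Import numFieldNormedType.Exports.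
Local Open Scope classical_set_scope.
Local Open Scope ring_scope.

Set Implicit Arguments.
Unset Strict Implicit.

(** * Arrival times and the index of the last arrival *)

Section Arrivals.
Context {R : realType}.
Implicit Types (D t : R) (s : nat -> R).

Lemma arrival_ltW D N s : arrival_times D N s ->
  forall i j, (i < j <= N.+1)%N -> s i < s j.
Proof.
move=> [_ _ sS] i; elim=> [|j IHj]; first by rewrite ltn0.
rewrite ltnS => /andP[]; rewrite leq_eqVlt => /predU1P[-> jN|ij jN].
  exact: sS.
by rewrite (lt_trans (IHj _)) ?sS// ij/= ltnW.
Qed.

Lemma arrival_le D N s : arrival_times D N s ->
  forall i j, (i <= j <= N.+1)%N -> s i <= s j.
Proof.
move=> sP i j /andP[]; rewrite leq_eqVlt => /predU1P[->//|ij jN].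
by rewrite ltW// (arrival_ltW sP)// ij.
Qed.

Lemma arrival_itv D N s k : arrival_times D N s -> (k <= N.+1)%N ->
  0 <= s k <= D.
Proof.
move=> sP kN; have [s0 sD _] := sP.
by rewrite -s0 -sD !(arrival_le sP)// ?kN ?leqnn.
Qed.

Lemma arrival_locate D N s t : arrival_times D N s -> 0 < t <= D ->
  exists2 k, (k <= N)%N & s k < t <= s k.+1.
Proof.
move=> [s0 sD _] /andP[t0 tD]; apply: contrapT => nex.
suff lt_s k : (k <= N.+1)%N -> s k < t.
  by have := lt_s N.+1 (leqnn _); rewrite sD ltNge tD.
elim: k => [|k IHk kN]; first by rewrite s0.
rewrite ltNge; apply/negP => tk; apply: nex; exists k; first exact: kN.
by apply/andP; split=> //; apply: IHk; exact: ltnW.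
Qed.

(** The interval is open on the left because [last_arrival] counts the arrivals strictly before [t]:
    at the instant [s k.+1] itself the energy [E k.+1] is not yet available. *)
Lemma last_arrivalE D N s k t : arrival_times D N s -> (k <= N)%N ->
  s k < t <= s k.+1 -> last_arrival N s t = k.
Proof.
move=> sP kN /andP[kt tk]; apply/eqP; rewrite eqn_leq; apply/andP; split.
  apply/bigmax_leqP => /= i it; rewrite leqNgt; apply/negP => ki.
  have := lt_le_trans it tk; apply/negP; rewrite -leNgt (arrival_le sP)//.
  by rewrite ki ltnW.
exact: (@leq_bigmax_cond _ (fun i : 'I_N.+1 => s i < t) (fun i => i : nat)
  (Ordinal (kN : (k < N.+1)%N))).
Qed.

End Arrivals.

(** * The constraints in terms of real-valued integrals *)

Section Constraints.
Context {R : realType}.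
Implicit Types (D a b Te Tc t : R) (N : nat) (s E : nat -> R) (P Q : R -> R).

Local Notation mu := (@lebesgue_measure R).

Definition energy P t : R := \int[mu]_(x in `[0, t]) P x.

(** The temperature excess over [Te] multiplied by e^{bt}; in these terms the critical temperature
    becomes the curve [(Tc - Te) * expR (b * t)]. *)
Definition heat a b P t : R := \int[mu]_(x in `[0, t]) (a * expR (b * x) * P x).

(** Energy causality is kept only at [s 1], ..., [s N.+1]: between two arrivals the budget is
    constant while consumption grows, so the right end of each interval is the critical instant. *)
Definition real_feasible D a b Te Tc N s E P : Prop :=
  [/\ is_policy D P, mu.-integrable `[0, D] (EFin \o P),
      forall t, 0 <= t <= D -> heat a b P t <= (Tc - Te) * expR (b * t)
    & forall k, (k <= N)%N -> energy P (s k.+1) <= \sum_(i < k.+1) E i].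

Lemma sub_itv0 D t : t <= D -> `[0, t] `<=` (`[0, D] : set R).
Proof. by move=> tD; apply: subset_itvl; rewrite bnd_simp. Qed.

Lemma continuous_integrable (h : R -> R) (t : R) : continuous h ->
  mu.-integrable `[0, t] (EFin \o h).
Proof.
move=> ch; apply: continuous_compact_integrable; first exact: segment_compact.
exact: continuous_subspaceT.
Qed.

Lemma integrable_weight D (h P : R -> R) : continuous h ->
  mu.-integrable `[0, D] (EFin \o P) ->
  mu.-integrable `[0, D] (EFin \o (fun x => h x * P x)).
Proof.
move=> ch iP.
have -> : EFin \o (fun x => h x * P x) = ((EFin \o h) \* (EFin \o P))%E.
  by apply/funext => x /=; rewrite EFinM.
apply: integrableMr => //.
  by apply: measurable_funTS; exact: continuous_measurable_fun.
have [M [_ HM]] : bounded_set (h @` `[0, D]).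
  apply: compact_bounded; apply: continuous_compact.
    exact: continuous_subspaceT.
  exact: segment_compact.
exists M; split; first exact: num_real.
by move=> y My x xD; apply: HM => //; exists x.
Qed.

Lemma continuous_expM (c b : R) : continuous (fun x : R => c * expR (b * x)).
Proof.
move=> x; apply: cvgMr; apply: continuous_comp; last exact: continuous_expR.
by apply: cvgMr; exact: cvg_id.
Qed.

Lemma continuous_expN (b : R) : continuous (fun x : R => expR (- (b * x))).
Proof.
suff -> : (fun x => expR (- (b * x))) = (fun x => 1 * expR (- b * x)).
  exact: continuous_expM.
by apply/funext => x; rewrite mul1r mulNr.
Qed.

Lemma integrable_heat D a b P : mu.-integrable `[0, D] (EFin \o P) ->
  mu.-integrable `[0, D] (EFin \o (fun x => a * expR (b * x) * P x)).
Proof. by move=> iP; apply: integrable_weight => //; exact: continuous_expM. Qed.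

Lemma integrable_le D t (f : R -> R) : t <= D ->
  mu.-integrable `[0, D] (EFin \o f) -> mu.-integrable `[0, t] (EFin \o f).
Proof. by move=> tD; apply: integrableS => //; exact: sub_itv0. Qed.

Lemma consumedE D P t : mu.-integrable `[0, D] (EFin \o P) -> t <= D ->
  consumed P t = (energy P t)%:E.
Proof.
move=> iP tD; rewrite /consumed /energy /Rintegral fineK//.
by apply: integrable_fin_num => //; exact: integrable_le iP.
Qed.

Lemma temperatureE D a b Te P t : mu.-integrable `[0, D] (EFin \o P) ->
  t <= D ->
  temperature a b Te P t = (Te + expR (- (b * t)) * heat a b P t)%:E.
Proof.
move=> iP tD; rewrite /temperature /heat EFinD EFinM /Rintegral fineK//.
by apply: integrable_fin_num => //; apply: integrable_le tD _; exact: integrable_heat.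
Qed.

Lemma energy_le D P t u : is_policy D P ->
  mu.-integrable `[0, D] (EFin \o P) -> t <= u <= D -> energy P t <= energy P u.
Proof.
move=> [mP P0] iP /andP[tu uD]; rewrite -lee_fin.
rewrite -!(@consumedE D)//; last exact: le_trans uD.
apply: ge0_subset_integral => //; last exact: sub_itv0.
  apply/measurable_EFinP; apply: measurable_funS mP => //; exact: sub_itv0.
by move=> x /= xu; rewrite lee_fin P0//; exact: (sub_itv0 uD).
Qed.

Lemma temp_leE (b Te Tc U t : R) :
  (Te + expR (- (b * t)) * U <= Tc) = (U <= (Tc - Te) * expR (b * t)).
Proof. by rewrite addrC -lerBrDr expRN mulrC ler_pdivrMr ?expR_gt0. Qed.

Lemma temp_ltE (b Te Tc U t : R) :
  (Te + expR (- (b * t)) * U < Tc) = (U < (Tc - Te) * expR (b * t)).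
Proof. by rewrite addrC -ltrBrDr expRN mulrC ltr_pdivrMr ?expR_gt0. Qed.

(** Causality at [D] bounds the integral of the nonnegative [P], hence gives integrability; all
    extended-real integrals are then finite and equal their real counterparts. Conversely,
    monotonicity of [energy] recovers causality between arrivals. *)
Lemma feasibleP D a b Te Tc N s E P : 0 < D -> arrival_times D N s ->
  feasible D a b Te Tc N s E P <-> real_feasible D a b Te Tc N s E P.
Proof.
move=> D0 sP; have [s0 sD _] := sP.
have pos_s k : (k <= N)%N -> 0 < s k.+1.
  by move=> kN; rewrite -s0 (arrival_ltW sP).
have s_leD k : (k <= N)%N -> s k.+1 <= D.
  by move=> kN; have /andP[] := @arrival_itv _ _ _ _ k.+1 sP kN.
have lastE k : (k <= N)%N -> last_arrival N s (s k.+1) = k.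
  by move=> kN; rewrite (last_arrivalE sP kN)// lexx (arrival_ltW sP)// ltnSn.
split=> [[pP tP cP]|[pP iP hP eP]].
  have iP : mu.-integrable `[0, D] (EFin \o P).
    apply/integrableP; split; first by apply/measurable_EFinP; case: pP.
    apply: (@le_lt_trans _ _ (consumed P D)).
      rewrite le_eqVlt; apply/orP; left; apply/eqP.
      apply: eq_integral => x; rewrite inE/= => xD.
      by rewrite ger0_norm//; apply: pP.2.
    by rewrite (le_lt_trans (cP D _)) ?ltry// in_itv/= D0 lexx.
  split => // [t t0D|k kN].
    have /andP[t0 tD] := t0D.
    by rewrite -temp_leE -lee_fin -(@temperatureE D)// tP.
  rewrite -lee_fin -(@consumedE D)// ?s_leD//.
  have := cP (s k.+1); rewrite lastE//; apply.
  by rewrite in_itv/= pos_s//= s_leD.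
split=> // t; rewrite in_itv/= => /andP[t0 tD].
  by rewrite (@temperatureE D)// lee_fin temp_leE hP// t0.
have [|k kN skt] := @arrival_locate _ _ _ _ t sP; first by rewrite t0.
rewrite (last_arrivalE sP kN skt) (@consumedE D)// lee_fin.
rewrite (le_trans _ (eP _ kN))// (@energy_le D)//.
by case/andP: skt => _ ->; rewrite s_leD.
Qed.

End Constraints.

(** * Moving power from one set to another *)

Section Exchange.
Context {R : realType}.
Implicit Types (D a b Te Tc t e : R) (N : nat) (s E : nat -> R).
Implicit Types (P Q h g w : R -> R) (X Y : set R).

Local Notation mu := (@lebesgue_measure R).

(** The divisor is the measure of all of [X], not of its part in [[0, t]]: this is the share of the
    average of [h] over [X] accumulated by time [t], and the full average once [X] lies in
    [[0, t]]. *)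
Definition mean h X t : R := (\int[mu]_(x in `[0, t] `&` X) h x) / fine (mu X).

Lemma finite_mu D X : X `<=` `[0, D] -> measurable X -> mu X \is a fin_num.
Proof.
move=> XD mX; rewrite ge0_fin_numE//.
apply: (@le_lt_trans _ _ (mu (`[0, D] : set R))).
  by apply: le_measure; rewrite ?inE.
by rewrite lebesgue_measure_itv/=; case: ifP => _; rewrite -?EFinD ltry.
Qed.

Lemma fine_mu_gt0 D X : X `<=` `[0, D] -> measurable X -> (0 < mu X)%E ->
  0 < fine (mu X).
Proof. by move=> XD mX X0; rewrite fine_gt0// X0 -ge0_fin_numE// (finite_mu XD). Qed.

Section Mean.
Variables (D t : R) (X : set R) (h : R -> R).
Hypotheses (XD : X `<=` `[0, D]) (mX : measurable X) (X0 : (0 < mu X)%E).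
Hypothesis ch : continuous h.

Let mtX : measurable (`[0, t] `&` X).
Proof. exact: measurableI. Qed.

Let itX : mu.-integrable (`[0, t] `&` X) (EFin \o h).
Proof.
exact: integrableS (@subIsetl _ _ _) (continuous_integrable t ch).
Qed.

Let ick k : mu.-integrable (`[0, t] `&` X) (EFin \o (cst k : R -> R)).
Proof.
have ck : continuous (cst k : R -> R) by move=> x; exact: cvg_cst.
exact: integrableS (@subIsetl _ _ _) (continuous_integrable t ck).
Qed.

Lemma mean_le (k : R) : 0 <= k -> (forall x, X x -> h x <= k) -> mean h X t <= k.
Proof.
move=> k0 hk; rewrite /mean ler_pdivrMr ?(fine_mu_gt0 XD)//.
apply: (@le_trans _ _ (\int[mu]_(x in `[0, t] `&` X) k)).
  by apply: le_Rintegral => //; [exact: ick|move=> x [_]; exact: hk].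
rewrite Rintegral_cst// ler_wpM2l// fine_le ?(finite_mu XD)//.
  by apply: (@finite_mu D) => // x [_ /XD].
by apply: le_measure; rewrite ?inE//; exact: subIsetr.
Qed.

Lemma mean_ge (k : R) : X `<=` `[0, t] -> (forall x, X x -> k <= h x) ->
  k <= mean h X t.
Proof.
move=> Xt hk; rewrite /mean ler_pdivlMr ?(fine_mu_gt0 XD)//.
apply: (@le_trans _ _ (\int[mu]_(x in `[0, t] `&` X) k)).
  by rewrite Rintegral_cst// (setIidr Xt).
by apply: le_Rintegral => //; [exact: ick|move=> x [_]; exact: hk].
Qed.

Lemma mean_ge0 : (forall x, X x -> 0 <= h x) -> 0 <= mean h X t.
Proof.
move=> h0; rewrite /mean divr_ge0//; last by rewrite fine_ge0.
by apply: Rintegral_ge0 => x [_]; exact: h0.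
Qed.

Lemma mean_disjoint : `[0, t] `&` X = set0 -> mean h X t = 0.
Proof. by move=> tX; rewrite /mean tX Rintegral_set0 mul0r. Qed.

End Mean.

(** The number [k] separates the values of [h] on [X] from those on [Y]. Before [X] begins the left
    side is 0; once [Y] is complete the right side is a full average, hence at least [k]. *)
Lemma mean_le_mean D t h X Y (k : R) :
  X `<=` `[0, D] -> measurable X -> (0 < mu X)%E ->
  Y `<=` `[0, D] -> measurable Y -> (0 < mu Y)%E -> continuous h -> 0 <= k ->
  (forall x, X x -> h x <= k) -> (forall x, Y x -> k <= h x) ->
  `[0, t] `&` X = set0 \/ Y `<=` `[0, t] -> mean h X t <= mean h Y t.
Proof.
move=> XD mX X0 YD mY Y0 ch k0 hX hY [tX|Yt].
  rewrite mean_disjoint//; apply: mean_ge0 => // x Yx.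
  by rewrite (le_trans k0) ?hY.
exact: (le_trans (mean_le _ XD mX X0 ch k0 hX) (mean_ge YD mY Y0 ch Yt hY)).
Qed.

(** Power of profile [w] is removed on [Y] and added on [X]. Dividing by the measures makes the two
    amounts equal when weighted by 1/w: [w = 1] preserves the total energy, and w = e^{-bx}
    preserves the total heat. *)
Definition exchange w X Y e P x : R :=
  P x + e * w x * (\1_X x / fine (mu X) - \1_Y x / fine (mu Y)).

(** Taking [g] to be 1 gives the energy and a e^{bx} gives the heat, so both constraints reduce to
    comparing means over [X] and [Y]. *)
Lemma integral_exchange D t g w X Y e P : t <= D ->
  measurable X -> measurable Y -> continuous g -> continuous w ->
  mu.-integrable `[0, D] (EFin \o P) ->
  \int[mu]_(x in `[0, t]) (g x * exchange w X Y e P x) =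
  \int[mu]_(x in `[0, t]) (g x * P x) +
    e * (mean (g \* w) X t - mean (g \* w) Y t).
Proof.
move=> tD mX mY cg cw iP.
have cgw : continuous (g \* w) by move=> x; apply: cvgM; [exact: cg|exact: cw].
have ires (Z : set R) : measurable Z ->
    mu.-integrable `[0, t] (EFin \o ((g \* w) \_ Z)).
  move=> mZ; rewrite -restrict_EFin; apply/integrable_restrict => //.
  apply: integrableS (@subIsetl _ _ _) (continuous_integrable t cgw) => //.
  exact: measurableI.
have iZ (Z : set R) (k : R) : measurable Z ->
    mu.-integrable `[0, t] (EFin \o (fun x => k * ((g \* w) \_ Z) x)).
  move=> mZ; apply: eq_integrable (integrableZl _ k (ires _ mZ)) => //.
pose f Z := fun x => e / fine (mu Z) * ((g \* w) \_ Z) x.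
have -> : (fun x => g x * exchange w X Y e P x) =
    (fun x => g x * P x + (f X x - f Y x)).
  apply/funext => x; rewrite /exchange /f !patch_indic/=.
  by ring.
rewrite RintegralD//; last 2 first.
- by apply: integrable_le tD _; exact: integrable_weight.
- have := integrableB _ (iZ X (e / fine (mu X)) mX) (iZ Y (e / fine (mu Y)) mY).
  by move=> /(_ (measurable_itv _)) H; apply: eq_integrable H.
rewrite RintegralB//; [|exact: iZ|exact: iZ].
rewrite !RintegralZl//; [|exact: ires|exact: ires].
by rewrite -!Rintegral_mkcondr /mean; ring.
Qed.

Lemma integrable_exchange D w X Y e P : measurable X -> measurable Y ->
  continuous w -> mu.-integrable `[0, D] (EFin \o P) ->
  mu.-integrable `[0, D] (EFin \o exchange w X Y e P).
Proof.
move=> mX mY cw iP.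
have ires (Z : set R) (k : R) : measurable Z ->
    mu.-integrable `[0, D] (EFin \o (fun x => k * (w \_ Z) x)).
  move=> mZ; have : mu.-integrable `[0, D] (EFin \o (w \_ Z)).
    rewrite -restrict_EFin; apply/integrable_restrict => //.
    apply: integrableS (@subIsetl _ _ _) (continuous_integrable D cw) => //.
    exact: measurableI.
  by move=> iw; apply: eq_integrable (integrableZl _ k iw) => //.
apply: eq_integrable (integrableD _ iP
  (integrableB _ (ires X (e / fine (mu X)) mX) (ires Y (e / fine (mu Y)) mY)))
  => // x _ /=.
by rewrite -EFinB -EFinD /exchange !patch_indic/=; congr EFin; ring.
Qed.

Definition rate P x : R := 2^-1 * (ln (1 + P x) / ln 2).

Lemma ln2_gt0 : 0 < ln 2 :> R.
Proof. by rewrite ln_gt0// ltr1n. Qed.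

Lemma measurable_rate D P : measurable_fun `[0, D] P ->
  measurable_fun `[0, D] (rate P).
Proof.
move=> mP; apply: measurable_funM => //; apply: measurable_funM => //.
apply: (@measurableT_comp _ _ _ _ _ _ (@ln R) _ (fun x => 1 + P x)) => //.
exact: measurable_funD.
Qed.

Lemma integrable_rate D P : is_policy D P ->
  mu.-integrable `[0, D] (EFin \o P) -> mu.-integrable `[0, D] (EFin \o rate P).
Proof.
move=> [mP P0] iP.
apply: le_integrable (integrableZl _ (2^-1 / ln 2) iP) => //.
  by apply/measurable_EFinP; exact: measurable_rate.
move=> x xD /=; rewrite lee_fin /rate.
have Px : 0 <= P x by exact: P0.
have l0 : 0 <= ln (1 + P x) by rewrite ln_ge0// lerDl.
rewrite !ger0_norm ?mulr_ge0 ?invr_ge0 ?(ltW ln2_gt0)//.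
rewrite mulrAC mulrA ler_wpM2r ?invr_ge0 ?(ltW ln2_gt0)//.
rewrite ler_wpM2l ?invr_ge0// le_ln1Dx//.
by rewrite (lt_le_trans _ Px)// oppr_lt0.
Qed.

Lemma throughputE D P : is_policy D P -> mu.-integrable `[0, D] (EFin \o P) ->
  throughput D P = (\int[mu]_(x in `[0, D]) rate P x)%:E.
Proof.
move=> pP iP; rewrite /throughput /Rintegral fineK//.
by apply: integrable_fin_num => //; exact: integrable_rate.
Qed.

(** This is ln(1 + z) <= z at z = u/v - 1. It serves both where power is added and where it is
    removed. *)
Lemma ln_sub_ge (u v : R) : 0 < u -> 0 < v -> 1 - u / v <= ln v - ln u.
Proof.
move=> u0 v0; have := @le_ln1Dx R (u / v - 1).
rewrite addrCA subrr addr0 ln_div ?posrE//.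
have -> : -1 < u / v - 1 by rewrite ltrBrDr addNr divr_gt0.
by move=> /(_ isT); lra.
Qed.

End Exchange.

(** * Gain in throughput from an exchange *)

Section ExchangeGain.
Context {R : realType}.
Local Notation mu := (@lebesgue_measure R).

Section Gain.
Variables (D : R) (w P : R -> R) (X Y : set R) (c c' e : R).
Hypotheses (pP : is_policy D P) (iP : mu.-integrable `[0, D] (EFin \o P)).
Hypotheses (XD : X `<=` `[0, D]) (mX : measurable X) (X0 : (0 < mu X)%E).
Hypotheses (YD : Y `<=` `[0, D]) (mY : measurable Y) (Y0 : (0 < mu Y)%E).
Hypothesis XY : forall x, X x -> ~ Y x.
Hypotheses (cw : continuous w) (w0 : forall x, 0 < w x).
Hypotheses (c0 : 0 < c) (e0 : 0 < e).
(** The ratio (1 + P)/w is at most [c] on [X] and at least [c'] on [Y]. The exchange raises it by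
    [e / fine (mu X)] and lowers it by [e / fine (mu Y)] respectively; the two ranges must remain
    separated afterwards. *)
Hypothesis cXY : c + e / fine (mu X) < c' - e / fine (mu Y).
Hypothesis PX : forall x, X x -> 1 + P x <= c * w x.
Hypothesis PY : forall x, Y x -> c' * w x <= 1 + P x.
Hypothesis PYe : forall x, Y x -> e * w x / fine (mu Y) <= P x.

Local Notation x1 := (fine (mu X)).
Local Notation y1 := (fine (mu Y)).
Local Notation P' := (exchange w X Y e P).

Let x1_gt0 : 0 < x1. Proof. exact: fine_mu_gt0 XD mX X0. Qed.
Let y1_gt0 : 0 < y1. Proof. exact: fine_mu_gt0 YD mY Y0. Qed.

Lemma exchangeX x : X x -> P' x = P x + e * w x / x1.
Proof.
move=> Xx; have nYx : ~ Y x.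
  exact: XY.
by rewrite /exchange !indicE mem_set// memNset// mul0r subr0 mul1r.
Qed.

Lemma exchangeY x : Y x -> P' x = P x - e * w x / y1.
Proof.
move=> Yx; have nXx : ~ X x.
  by move=> Xx; exact: XY Yx.
by rewrite /exchange !indicE memNset// mem_set// mul0r sub0r mul1r mulrN.
Qed.

Lemma exchange_id x : ~ X x -> ~ Y x -> P' x = P x.
Proof.
by move=> Xx Yx; rewrite /exchange !indicE !memNset// !mul0r subr0 mulr0 addr0.
Qed.

Lemma exchange_policy : is_policy D P'.
Proof.
have [mP P0] := pP; split.
  have := measurable_int _ (integrable_exchange e mX mY cw iP).
  by move=> /measurable_EFinP.
move=> x xD; have Px := P0 _ xD.
have [Xx|Xx] := pselect (X x).
  by rewrite exchangeX// addr_ge0// divr_ge0 ?ltW// mulr_gt0.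
have [Yx|Yx] := pselect (Y x); last by rewrite exchange_id.
by rewrite exchangeY// subr_ge0 PYe.
Qed.

(** Pointwise bounds: ln(1 + P) rises by at least [rX] on [X] and falls by at most [rY] on [Y]. *)
Let rX := e / x1 / (c + e / x1).
Let rY := e / y1 / (c' - e / y1).

Let cX_gt0 : 0 < c + e / x1.
Proof. by rewrite addr_gt0// divr_gt0. Qed.

Let cY_gt0 : 0 < c' - e / y1.
Proof. exact: lt_trans cX_gt0 cXY. Qed.

Let gain_ge x : x \in `[0, D] ->
  rX * \1_X x - rY * \1_Y x <= ln (1 + P' x) - ln (1 + P x).
Proof.
move=> xD; have Px : 0 <= P x by exact: pP.2.
have P'x : 0 <= P' x by exact: exchange_policy.2.
have P1 : 0 < 1 + P x by lra.
have P'1 : 0 < 1 + P' x by lra.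
apply: (le_trans _ (ln_sub_ge P1 P'1)).
have wx := w0 x.
have [Xx|Xx] := pselect (X x).
  have nYx : ~ Y x.
    exact: XY.
  rewrite !indicE mem_set// memNset// mulr1 mulr0 subr0.
  have -> : 1 - (1 + P x) / (1 + P' x) = (e / x1 * w x) / (1 + P' x).
    have P'xE := exchangeX Xx.
    have -> : 1 + P x = 1 + P' x - e / x1 * w x by rewrite P'xE; ring.
    by field; rewrite ?gt_eqF.
  have le1 : 1 + P' x <= (c + e / x1) * w x.
    by have := PX Xx; rewrite (exchangeX Xx) mulrDl; lra.
  rewrite ler_pdivlMr//.
  have -> : rX * (1 + P' x) = e / x1 * ((1 + P' x) / (c + e / x1)).
    by rewrite /rX; ring.
  by rewrite ler_pM2l ?divr_gt0// ler_pdivrMr// mulrC.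
have [Yx|Yx] := pselect (Y x); last first.
  rewrite !indicE !memNset// !mulr0 subr0 (exchange_id Xx Yx).
  by rewrite divff ?subrr ?gt_eqF.
rewrite !indicE memNset// mem_set// mulr1 mulr0 sub0r.
have -> : 1 - (1 + P x) / (1 + P' x) = - ((e / y1 * w x) / (1 + P' x)).
  have P'xE := exchangeY Yx.
  have -> : 1 + P x = 1 + P' x + e / y1 * w x by rewrite P'xE; ring.
  by field; rewrite ?gt_eqF.
have le1 : (c' - e / y1) * w x <= 1 + P' x.
  by have := PY Yx; rewrite (exchangeY Yx) mulrBl; lra.
rewrite lerN2 ler_pdivrMr//.
have -> : rY * (1 + P' x) = e / y1 * ((1 + P' x) / (c' - e / y1)).
  by rewrite /rY; ring.
by rewrite ler_pM2l ?divr_gt0// ler_pdivlMr// mulrC.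
Qed.

(** Integrated over [X] and [Y], the pointwise bounds give a rise of at least [e / (c + e / x1)] and
    a fall of at most [e / (c' - e / y1)], up to the common factor [k]; [cXY] makes the rise the
    larger one. *)
Lemma exchange_gain : (throughput D P < throughput D P')%E.
Proof.
have pP' := exchange_policy.
have iP' := integrable_exchange e mX mY cw iP.
rewrite !throughputE// lte_fin -subr_gt0.
rewrite -RintegralB//; [|exact: integrable_rate|exact: integrable_rate].
pose k := 2^-1 / ln 2 : R.
have k0 : 0 < k by rewrite divr_gt0 ?invr_gt0 ?ln2_gt0.
have iI (Z : set R) : measurable Z -> mu.-integrable `[0, D] (EFin \o \1_Z).
  move=> mZ; have ck : continuous (cst 1 : R -> R) by move=> x; exact: cvg_cst.
  have -> : \1_Z = (cst 1 : R -> R) \_ Z.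
    by apply/funext => x; rewrite patch_indic/= mul1r.
  rewrite -restrict_EFin; apply/integrable_restrict => //.
  apply: integrableS (@subIsetl _ _ _) (continuous_integrable D ck) => //.
  exact: measurableI.
have iZ (Z : set R) (r : R) : measurable Z ->
    mu.-integrable `[0, D] (EFin \o (fun x => r * \1_Z x)).
  by move=> mZ; apply: eq_integrable (integrableZl _ r (iI _ mZ)) => //.
have intI (Z : set R) : Z `<=` `[0, D] -> measurable Z ->
    \int[mu]_(x in `[0, D]) \1_Z x = fine (mu Z).
  by move=> ZD mZ; rewrite /Rintegral integral_indic// setIidl.
apply: (@lt_le_trans _ _
    (\int[mu]_(x in `[0, D]) (k * rX * \1_X x - k * rY * \1_Y x))).
  rewrite RintegralB//; [|exact: iZ|exact: iZ].
  rewrite !RintegralZl//; [|exact: iI|exact: iI].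
  rewrite !intI// subr_gt0.
  have -> : k * rX * x1 = k * (e / (c + e / x1)).
    by rewrite -mulrA; congr (_ * _); rewrite /rX mulrAC divfK ?gt_eqF.
  have -> : k * rY * y1 = k * (e / (c' - e / y1)).
    by rewrite -mulrA; congr (_ * _); rewrite /rY mulrAC divfK ?gt_eqF.
  by rewrite !ltr_pM2l// ltf_pV2.
apply: le_Rintegral => //.
- have := integrableB _ (iZ X (k * rX) mX) (iZ Y (k * rY) mY).
  by move=> /(_ (measurable_itv _)) H; apply: eq_integrable H.
- have := integrableB _ (integrable_rate pP' iP') (integrable_rate pP iP).
  by move=> /(_ (measurable_itv _)) H; apply: eq_integrable H.
move=> x xD; have := gain_ge xD.
rewrite -(ler_pM2l k0).
have -> : k * (rX * \1_X x - rY * \1_Y x) = k * rX * \1_X x - k * rY * \1_Y x.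
  by ring.
have -> // : k * (ln (1 + P' x) - ln (1 + P x)) = rate P' x - rate P x.
by rewrite /rate /k; ring.
Qed.

End Gain.

(* The feasibility conditions are those of the exchanged policy for every small
   enough amount [e]. *)
Lemma exchange_not_optimal (D a b Te Tc : R) N (s E : nat -> R)
    (w P : R -> R) (X Y : set R) (c c' q0 e0 : R) :
  0 < D -> arrival_times D N s -> optimal D a b Te Tc N s E P ->
  X `<=` `[0, D] -> measurable X -> (0 < mu X)%E ->
  Y `<=` `[0, D] -> measurable Y -> (0 < mu Y)%E ->
  (forall x, X x -> ~ Y x) -> continuous w -> (forall x, 0 < w x) ->
  (forall x, Y x -> w x <= 1) ->
  0 < c -> c < c' -> 0 < q0 -> 0 < e0 ->
  (forall x, X x -> 1 + P x <= c * w x) ->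
  (forall x, Y x -> c' * w x <= 1 + P x) ->
  (forall x, Y x -> q0 <= P x) ->
  (forall e : R, 0 < e <= e0 -> forall t : R, 0 <= t <= D ->
    heat a b P t + e * (mean ((fun x => a * expR (b * x)) \* w) X t
                      - mean ((fun x => a * expR (b * x)) \* w) Y t)
      <= (Tc - Te) * expR (b * t)) ->
  (forall e : R, 0 < e <= e0 -> forall k, (k <= N)%N ->
    energy P (s k.+1) + e * (mean w X (s k.+1) - mean w Y (s k.+1))
      <= \sum_(i < k.+1) E i) ->
  False.
Proof.
move=> D0 sP [fP optP] XD mX X0 YD mY Y0 XY cw w0 w1 c0 cc' q00 e00.
move=> PX PY PYq Hheat Henergy.
have [pP iP hP eP] := (feasibleP a b Te Tc E P D0 sP).1 fP.
have x1_gt0 := fine_mu_gt0 XD mX X0; have y1_gt0 := fine_mu_gt0 YD mY Y0.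
set x1 := fine (mu X) in x1_gt0; set y1 := fine (mu Y) in y1_gt0.
pose r := x1^-1 + y1^-1.
have r0 : 0 < r by rewrite addr_gt0 ?invr_gt0.
(* The three bounds ensure, in order, feasibility, nonnegative power on [Y] (as [w <= 1] there), and
   a loss of at most half of the gap [c' - c]. *)
pose e := Num.min e0 (Num.min (q0 * y1) ((c' - c) / (2 * r))).
have e_gt0 : 0 < e.
  by rewrite !lt_min e00 mulr_gt0//= divr_gt0 ?mulr_gt0 ?subr_gt0.
have e_le : e <= e0 by rewrite ge_min lexx.
have e_leq : e <= q0 * y1 by rewrite !ge_min lexx orbT.
have e_lec : e <= (c' - c) / (2 * r) by rewrite !ge_min lexx !orbT.
have cXY : c + e / x1 < c' - e / y1.
  suff : e * r < c' - c by rewrite /r; lra.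
  have : e * r <= (c' - c) / 2.
    by move: e_lec; rewrite invfM mulrA ler_pdivlMr.
  by move=> /le_lt_trans; apply; lra.
have PYe x : Y x -> e * w x / y1 <= P x.
  move=> Yx; apply: le_trans (PYq _ Yx); rewrite ler_pdivrMr//.
  by apply: le_trans e_leq; rewrite ler_piMr ?w1// ltW.
have pP' := exchange_policy pP iP XD mX X0 mY XY cw w0 e_gt0 PYe.
have iP' := integrable_exchange e mX mY cw iP.
have gain := exchange_gain pP iP XD mX X0 YD mY Y0 XY cw w0 c0 e_gt0 cXY PX PY PYe.
have := optP (exchange w X Y e P); rewrite leNgt gain => /(_ _)/negP; apply => //.
apply/(feasibleP a b Te Tc E _ D0 sP); split => //.
  move=> t t0D; rewrite /heat (@integral_exchange _ D)//.
  - by apply: Hheat => //; rewrite e_gt0.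
  - by case/andP: t0D.
  - exact: continuous_expM.
move=> k kN; have /andP[s0 sD] := arrival_itv sP (kN : (k.+1 <= N.+1)%N).
have /= := @integral_exchange _ D (s k.+1) (cst 1) w X Y e P sD mX mY.
have -> : cst 1 \* w = w by apply/funext => x /=; rewrite mul1r.
have cst1 (f : R -> R) : (fun x => 1 * f x) = f.
  by apply/funext => x; rewrite mul1r.
rewrite !cst1 /energy => -> //; last by move=> x; exact: cvg_cst.
by apply: Henergy => //; rewrite e_gt0.
Qed.

End ExchangeGain.

(** * Heat balance where the temperature touches its bound *)

Section Perturbations.
Context {R : realType}.
Local Notation mu := (@lebesgue_measure R).

Section Heat.
Variables (D a b : R) (P : R -> R).
Hypotheses (a0 : 0 < a) (b0 : 0 < b).
Hypothesis iP : mu.-integrable `[0, D] (EFin \o P).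

Lemma heat_continuous : 0 < D -> {within `[0, D], continuous (heat a b P)}.
Proof.
move=> D0; apply: parameterized_integral_continuous; first exact: ltW.
exact: integrable_heat.
Qed.

Lemma integral_expR (k t0 t : R) : t0 < t ->
  \int[mu]_(x in `[t0, t]) (k * expR (b * x)) =
  k / b * (expR (b * t) - expR (b * t0)).
Proof.
move=> t0t; rewrite /Rintegral.
have dF (x : R) : is_derive x (1 : R) (fun x : R => k / b * expR (b * x))
      (k * expR (b * x)).
  apply: is_derive_eq; rewrite /GRing.scale/=.
  by field; rewrite gt_eqF.
have cF : continuous (fun x : R => k / b * expR (b * x)).
  exact: continuous_expM.
rewrite (@continuous_FTC2 _ _ (fun x => k / b * expR (b * x)))//=.
- by ring.
- by apply: continuous_subspaceT; exact: continuous_expM.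
- split=> [x _||]; first by have [] := dF x.
    by apply: cvg_at_right_filter; exact: cF.
  by apply: cvg_at_left_filter; exact: cF.
- by move=> x _; rewrite derive1E; have [_] := dF x.
Qed.

Section Increment.
Variables (t0 t : R).
Hypotheses (t00 : 0 <= t0) (t0t : t0 < t) (tD : t <= D).

Let f x := a * expR (b * x) * P x.

Let if_ : mu.-integrable `[t0, t] (EFin \o f).
Proof.
apply: integrableS (integrable_heat a b iP) => //.
by apply: subset_itvScc => /=; rewrite ?bnd_simp.
Qed.

Let ifo : mu.-integrable `]t0, t[ (EFin \o f).
Proof. by apply: integrableS if_ => //; exact: subset_itv_oo_cc. Qed.

Let heat_diff : heat a b P t - heat a b P t0 = \int[mu]_(x in `]t0, t[) f x.
Proof.
rewrite /heat Rintegral_itvB ?bnd_simp//; last 2 first.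
- by apply: integrable_le tD _; exact: integrable_heat.
- exact: ltW.
by rewrite -Rintegral_itv_bndo_bndc// (integrableS _ _ _ if_)//; exact: subset_itv_oc_cc.
Qed.

Let ie k : mu.-integrable `]t0, t[ (EFin \o (fun x => k * expR (b * x))).
Proof.
have sub : `]t0, t[ `<=` (`[0, t] : set R).
  by apply: (subset_trans (@subset_itv_oo_cc _ _ _ _)); apply: subset_itvScc.
have ii := continuous_integrable t (@continuous_expM R k b).
by apply: integrableS ii.
Qed.

Let int_e k : \int[mu]_(x in `]t0, t[) (k * expR (b * x)) =
  k / b * (expR (b * t) - expR (b * t0)).
Proof.
rewrite -integral_expR// Rintegral_itv_bndo_bndc ?Rintegral_itv_obnd_cbnd//.
have sub : `]t0, t] `<=` (`[0, t] : set R).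
  by apply: (subset_trans (@subset_itv_oc_cc _ _ _ _)); apply: subset_itvScc.
have ii := continuous_integrable t (@continuous_expM R k b).
by apply: integrableS ii.
Qed.

Lemma heat_increment_ge q : (forall x, t0 < x < t -> q <= P x) ->
  a * q / b * (expR (b * t) - expR (b * t0)) <= heat a b P t - heat a b P t0.
Proof.
move=> qP; rewrite heat_diff -int_e; apply: le_Rintegral => // x /=.
rewrite in_itv/= => xt; rewrite /f mulrAC ler_pM2l ?mulr_gt0 ?expR_gt0//.
exact: qP.
Qed.

Lemma heat_increment_le p : (forall x, t0 < x < t -> P x <= p) ->
  heat a b P t - heat a b P t0 <= a * p / b * (expR (b * t) - expR (b * t0)).
Proof.
move=> qP; rewrite heat_diff -int_e; apply: le_Rintegral => // x /=.
rewrite in_itv/= => xt; rewrite /f [leRHS]mulrAC ler_pM2l ?mulr_gt0 ?expR_gt0//.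
exact: qP.
Qed.

End Increment.

(** The curve [k * expR (b * t)] is followed exactly by the constant power kb/a. A trajectory that
    touches it at [t0] and lies below it at [t] cannot have gained more heat than the curve in
    between. *)
Lemma contact_right (k t0 t q : R) : 0 <= t0 -> t0 < t <= D ->
  heat a b P t0 = k * expR (b * t0) -> heat a b P t <= k * expR (b * t) ->
  (forall x, t0 < x < t -> q <= P x) -> a * q / b <= k.
Proof.
move=> t00 /andP[t0t tD] ht0 ht qP.
have := heat_increment_ge t00 t0t tD qP; rewrite ht0 => H.
have : a * q / b * (expR (b * t) - expR (b * t0)) <=
  k * (expR (b * t) - expR (b * t0)) by lra.
by rewrite ler_pM2r// subr_gt0 ltr_expR ltr_pM2l.
Qed.

(** Mirror image of [contact_right]: a trajectory below the curve at [t] that reaches it at [t0]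
    must have gained at least as much heat as the curve. *)
Lemma contact_left (k t0 t p : R) : 0 <= t -> t < t0 <= D ->
  heat a b P t0 = k * expR (b * t0) -> heat a b P t <= k * expR (b * t) ->
  (forall x, t < x < t0 -> P x <= p) -> k <= a * p / b.
Proof.
move=> t_ge0 /andP[tt0 t0D] ht0 ht pP.
have := heat_increment_le t_ge0 tt0 t0D pP; rewrite ht0 => H.
have : k * (expR (b * t0) - expR (b * t)) <=
  a * p / b * (expR (b * t0) - expR (b * t)) by lra.
by rewrite ler_pM2r// subr_gt0 ltr_expR ltr_pM2l.
Qed.

End Heat.

(** Makes finitely many strict inequalities uniform; [C] selects the relevant arrivals, and the
    margin is arbitrary when there are none. *)
Lemma finite_margin (f : nat -> R) (C : nat -> Prop) N :
  (forall k, (k <= N)%N -> C k -> 0 < f k) ->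
  exists2 e, 0 < e & forall k, (k <= N)%N -> C k -> e <= f k.
Proof.
elim: N => [|N IHN] fP.
  have [C0|nC0] := pselect (C 0%N).
    by exists (f 0%N); [exact: fP|move=> k; rewrite leqn0 => /eqP->].
  by exists 1 => // k; rewrite leqn0 => /eqP->.
have [k kN|e e0 fe] := IHN; first by apply: fP; exact: leqW.
have [CN|nCN] := pselect (C N.+1); last first.
  exists e => // k; rewrite leq_eqVlt => /predU1P[->//|]; exact: fe.
exists (Num.min e (f N.+1)); first by rewrite lt_min e0 fP.
move=> k; rewrite leq_eqVlt => /predU1P[-> _|kN Ck]; first by rewrite ge_min lexx orbT.
by rewrite ge_min fe.
Qed.

(** * The two exchanges excluded by optimality *)

Section Optimal.
Variables (D a b Te Tc : R) (N : nat) (s E : nat -> R) (P : R -> R).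
Hypotheses (D0 : 0 < D) (a0 : 0 < a) (b0 : 0 < b) (sP : arrival_times D N s).
Hypothesis oP : optimal D a b Te Tc N s E P.

Let fP : real_feasible D a b Te Tc N s E P.
Proof. by apply/feasibleP => //; exact: oP.1. Qed.

(** With profile w = e^{-bx} the ratio (1 + P)/w is e^{bx} (1 + P), so [c < c'] is exactly the gap
    needed for a gain. Neither constraint requires slack, so the bound on the amount is simply 1. *)
Lemma postpone_false (t c c' : R) (X Y : set R) : 0 <= t <= D -> c < c' ->
  measurable X -> measurable Y -> X `<=` `]t, D] -> Y `<=` `[0, t] ->
  (forall x, X x -> expR (b * x) * (1 + P x) <= c) ->
  (forall x, Y x -> c' <= expR (b * x) * (1 + P x)) ->
  (0 < mu X)%E -> (0 < mu Y)%E -> False.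
Proof.
move=> /andP[t0 tD] cc' mX mY Xt Yt XG YG X0 Y0.
have [pP iP hP eP] := fP.
have XD : X `<=` `[0, D].
  by move=> x /Xt/=; rewrite !in_itv/= => /andP[/ltW tx ->]; rewrite (le_trans t0 tx).
have YD : Y `<=` `[0, D] by move=> x /Yt/=; exact: sub_itv0.
have [y Xy] : X !=set0.
  by apply/set0P/eqP => XE; move: X0; rewrite XE measure0 ltxx.
have Py0 : 0 <= P y by apply: pP.2; exact: XD.
have ty : t < y by have /= := Xt _ Xy; rewrite in_itv/= => /andP[].
(* Since [P y >= 0] at a point [y] of [X], [c] exceeds e^{bt}. On [Y], which lies before [t], this
   gives 1 + P >= c'/c, whence the lower bound [c' / c - 1] for the removable power. *)
have ec : expR (b * t) < c.
  apply: (@lt_le_trans _ _ (expR (b * y))); first by rewrite ltr_expR ltr_pM2l.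
  by apply: le_trans (XG _ Xy); rewrite ler_peMr ?expR_ge0// lerDl.
have c0 : 0 < c by apply: lt_trans ec; exact: expR_gt0.
pose w x := expR (- (b * x)).
have cw : continuous w by exact: continuous_expN.
have w0 x : 0 < w x by exact: expR_gt0.
have eqw x : expR (b * x) * w x = 1 by rewrite expRxMexpNx_1.
have aw : (fun x => a * expR (b * x)) \* w = cst a.
  by apply/funext => x /=; rewrite -mulrA eqw mulr1.
have sides t' : `[0, t'] `&` X = set0 \/ Y `<=` `[0, t'].
  have [tt'|t't] := leP t t'.
    by right; apply: subset_trans Yt _; exact: sub_itv0.
  left; apply/seteqP; split=> // x [/=]; rewrite in_itv/= => /andP[_ xt'] /Xt/=.
  by rewrite in_itv/= ltNge (le_trans xt' (ltW t't)).
apply: (@exchange_not_optimal _ D a b Te Tc N s E w P X Y c c' (c' / c - 1) 1)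
  => //.
- by move=> x /Xt + /Yt; rewrite /= !in_itv/= => /andP[/lt_le_trans tx _] /andP[_ /tx];
     rewrite ltxx.
- move=> x /Yt/=; rewrite in_itv/= => /andP[x0 _].
  by rewrite /w -expR0 ler_expR oppr_le0 mulr_ge0// ltW.
- by rewrite subr_gt0 ltr_pdivlMr// mul1r.
- move=> x Xx; have := XG _ Xx; rewrite -(ler_pM2r (w0 x)).
  by rewrite mulrAC eqw mul1r.
- move=> x Yx; have := YG _ Yx; rewrite -(ler_pM2r (w0 x)).
  by rewrite [leRHS]mulrAC eqw mul1r.
- move=> x Yx; rewrite lerBlDl ler_pdivrMr//.
  apply: le_trans (YG _ Yx) _; rewrite mulrC ler_wpM2l//.
    by rewrite addr_ge0//; apply: pP.2; exact: YD.
  apply: ltW; apply: le_lt_trans ec; rewrite ler_expR ler_pM2l//.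
  by have /= := Yt _ Yx; rewrite in_itv/= => /andP[].
- move=> e /andP[e0 _] t' t'D; apply: le_trans (hP _ t'D).
  rewrite aw gerDl pmulr_rle0// subr_le0.
  apply: (@mean_le_mean _ D t' _ X Y a) => //; last exact: ltW.
  by move=> x; exact: cvg_cst.
- move=> e /andP[e0 _] k kN; apply: le_trans (eP _ kN).
  rewrite gerDl pmulr_rle0// subr_le0.
  apply: (@mean_le_mean _ D _ _ X Y (w t)) => //; first exact: ltW.
    move=> x /Xt/=; rewrite in_itv/= => /andP[tx _].
    by rewrite /w ler_expR lerN2 ler_pM2l// ltW.
  move=> x /Yt/=; rewrite in_itv/= => /andP[_ xt].
  by rewrite /w ler_expR lerN2 ler_pM2l.
Qed.

(** With constant profile the constraints tighten only for times in [[u, v[]: before [u] nothing has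
    changed, and from [v] on the energy is restored while the heat is no larger, its weight being
    smaller on [X]. Inside the window the strict hypotheses leave room. *)
Lemma advance_false (u m v p q : R) (X Y : set R) : 0 <= u <= m -> m <= v <= D ->
  0 <= p < q -> measurable X -> measurable Y ->
  X `<=` `[u, m] -> Y `<=` `]m, v] ->
  (forall x, X x -> P x <= p) -> (forall x, Y x -> q <= P x) ->
  (forall t : R, u <= t <= v -> heat a b P t < (Tc - Te) * expR (b * t)) ->
  (forall k, (k <= N)%N -> u <= s k.+1 < v ->
     energy P (s k.+1) < \sum_(i < k.+1) E i) ->
  (0 < mu X)%E -> (0 < mu Y)%E -> False.
Proof.
move=> /andP[u0 um] /andP[mv vD] /andP[p0 pq] mX mY Xum Ymv XP YP hlt elt X0 Y0.
have [pP iP hP eP] := fP.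
have uv := le_trans um mv.
have XD : X `<=` `[0, D].
  move=> x /Xum/=; rewrite !in_itv/= => /andP[/(le_trans u0)-> xm]/=.
  by rewrite (le_trans xm)// (le_trans mv).
have YD : Y `<=` `[0, D].
  move=> x /Ymv/=; rewrite !in_itv/= => /andP[mx xv]; rewrite (le_trans xv)// andbT.
  by rewrite (le_trans u0)// (le_trans um)// ltW.
(* Compactness of [[u, v]] turns the strict temperature bound into a uniform margin. *)
have [k1 k1_gt0 hmargin] : exists2 e, 0 < e & forall t, u <= t <= v ->
    heat a b P t + e <= (Tc - Te) * expR (b * t).
  pose F t := (Tc - Te) * expR (b * t) - heat a b P t.
  have cF : {within `[u, v], continuous F}.
    have sub : (`[u, v] : set R) `<=` `[0, D].
      by apply: subset_itvScc => /=; rewrite ?bnd_simp.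
    have c1 : {within `[u, v], continuous (fun t => (Tc - Te) * expR (b * t))}.
      by apply: continuous_subspaceT; exact: continuous_expM.
    have c2 := continuous_subspaceW sub (@heat_continuous D a b P iP D0).
    by move=> x; apply: cvgB; [exact: c1|exact: c2].
  have [c] := EVT_min uv cF; rewrite in_itv/= => cuv Fc.
  exists (F c); first by rewrite subr_gt0 hlt.
  move=> t tuv; have := Fc t; rewrite in_itv/= tuv => /(_ isT).
  by rewrite /F; lra.
have [k kN kuv|k2 k2_gt0 emargin] := @finite_margin
    (fun k => \sum_(i < k.+1) E i - energy P (s k.+1)) (fun k => u <= s k.+1 < v) N.
  by rewrite subr_gt0 elt.
pose w := cst 1 : R -> R.
have cw : continuous w by move=> x; exact: cvg_cst.
have aw : (fun x => a * expR (b * x)) \* w = (fun x => a * expR (b * x)).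
  by apply/funext => x /=; rewrite mulr1.
have sides t' : ~ (u <= t' < v) -> `[0, t'] `&` X = set0 \/ Y `<=` `[0, t'].
  move=> t'uv; have [vt'|t'v] := leP v t'.
    right; move=> x Yx; have /= := Ymv _ Yx; have /= := YD _ Yx.
    by rewrite !in_itv/= => /andP[-> _] /andP[_ /le_trans]; exact.
  have [ut'|t'u] := leP u t'; first by case: t'uv; rewrite ut'.
  left; apply/seteqP; split=> // x [/=]; rewrite in_itv/= => /andP[_ xt'] /Xum/=.
  by rewrite in_itv/= => /andP[/(lt_le_trans t'u)]; rewrite ltNge xt'.
have ca : continuous (fun x => a * expR (b * x)) by exact: continuous_expM.
pose k := a * expR (b * m).
have k0 : 0 < k by rewrite mulr_gt0// expR_gt0.
have Xk x : X x -> a * expR (b * x) <= k.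
  move=> /Xum/=; rewrite in_itv/= => /andP[_ xm].
  by rewrite ler_pM2l// ler_expR ler_pM2l.
have Yk x : Y x -> k <= a * expR (b * x).
  move=> /Ymv/=; rewrite in_itv/= => /andP[mx _].
  by rewrite ler_pM2l// ler_expR ler_pM2l// ltW.
(* Inside the window an amount [e] adds at most [e * k] to the heat, [k] being the heat weight at
   [m], and at most [e] to the energy; hence the bound [Num.min (k1 / k) k2]. *)
apply: (@exchange_not_optimal _ D a b Te Tc N s E w P X Y (1 + p) (1 + q) q
  (Num.min (k1 / k) k2)) => //.
- by move=> x /Xum + /Ymv; rewrite /= !in_itv/= => /andP[_ xm] /andP[];
     rewrite ltNge xm.
- by rewrite ltr_pwDl.
- by rewrite ltrD2l.
- exact: le_lt_trans pq.
- by rewrite lt_min k2_gt0 divr_gt0.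
- by move=> x /XP; rewrite mulr1 lerD2l.
- by move=> x /YP; rewrite mulr1 lerD2l.
- move=> e /andP[e0]; rewrite le_min => /andP[ek _] t t0D; rewrite aw.
  have [/andP[ut tv]|nt] := pselect (u <= t < v).
    apply: le_trans (hmargin t _); last by rewrite ut ltW.
    rewrite lerD2l; apply: (@le_trans _ _ (e * k)).
      rewrite ler_pM2l// lerBlDr (le_trans (mean_le t XD mX X0 ca (ltW k0) Xk))//.
      rewrite lerDl; apply: mean_ge0 => x /Yk; exact: le_trans (ltW k0).
    by rewrite -ler_pdivlMr.
  apply: le_trans (hP _ t0D); rewrite gerDl pmulr_rle0// subr_le0.
  apply: (@mean_le_mean _ D _ _ X Y k) => //; [exact: ltW|exact: sides].
- move=> e /andP[e0]; rewrite le_min => /andP[_ ek] j jN.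
  have [sj|nsj] := pselect (u <= s j.+1 < v).
    have := emargin j jN sj; rewrite lerBrDl; apply: le_trans.
    rewrite lerD2l (le_trans _ ek)// ler_piMr ?(ltW e0)//.
    rewrite lerBlDr (@le_trans _ _ 1)//.
      exact: (mean_le _ XD mX X0 cw ler01).
    by rewrite lerDl; apply: mean_ge0.
  apply: le_trans (eP _ jN); rewrite gerDl pmulr_rle0// subr_le0.
  by apply: (@mean_le_mean _ D _ _ X Y 1) => //; exact: sides.
Qed.

End Optimal.

End Perturbations.

(** * A version of the policy that is monotone up to an exponential factor *)

Section MonotoneVersion.
Context {R : realType}.
Local Notation mu := (@lebesgue_measure R).

(** The preimage of a ray [[r, +oo[] under a monotone function on an interval is again an
    interval. *)
Lemma nondecreasing_in_measurable (I : interval R) (f : R -> R) :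
  {in I &, nondecreasing_fun f} -> measurable_fun [set` I] f.
Proof.
move=> f_nd; apply: (measurability (@RGenCInfty.G R)) => [|/= _ [_] [r] -> <-].
  exact: RGenCInfty.measurableE.
apply: is_interval_measurable => x y /= [xI + [yI _]] z /andP[xz zy].
rewrite !in_itv/= !andbT => fx.
have zI : z \in I by apply: (@interval_is_interval _ I x y) => //; rewrite xz.
split; [by move: zI; rewrite in_itv|by rewrite /= (le_trans fx)// f_nd].
Qed.

Variables (D a b Te Tc : R) (N : nat) (s E : nat -> R) (P : R -> R).
Hypotheses (D0 : 0 < D) (a0 : 0 < a) (b0 : 0 < b) (sP : arrival_times D N s).
Hypothesis oP : optimal D a b Te Tc N s E P.

(** Up to a constant, 1/G is the marginal throughput per unit of heat. *)
Let G x := expR (b * x) * (1 + P x).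

Let fP : real_feasible D a b Te Tc N s E P.
Proof. by apply/feasibleP => //; exact: oP.1. Qed.

Let mG : measurable_fun `[0, D] G.
Proof.
have [[mP _] _ _ _] := fP.
apply: measurable_funM; last exact: measurable_funD.
apply: measurable_funTS; apply: continuous_measurable_fun.
suff -> : (fun x => expR (b * x)) = (fun x => 1 * expR (b * x)).
  exact: continuous_expM.
by apply/funext => x; rewrite mul1r.
Qed.

(** A decrease of [G] from [x] to [y] is witnessed by rationals [t] between the points and [c < c']
    between the values. Discarding the null sets among the countably many [A] and [B] makes the two
    sets that contain [x] and [y] non-null, against [postpone_false]. *)
Lemma exchange_monotone_ae : exists Z : set R, [/\ measurable Z, mu Z = 0 &
  forall x y : R, 0 < x -> x < y -> y < D -> ~ Z x -> ~ Z y -> G x <= G y].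
Proof.
pose A (t c : R) : set R := `[0, D] `&` G @^-1` `[c, +oo[ `&` `[0, t].
pose B (t c : R) : set R := `[0, D] `&` G @^-1` `]-oo, c] `&` `]t, D].
have mA t c : measurable (A t c).
  by apply: measurableI => //; exact: mG.
have mB t c : measurable (B t c).
  by apply: measurableI => //; exact: mG.
(* Triples of rationals are coded by naturals so that the countable intersection of
   almost-everywhere statements applies. *)
pose Pn (n : nat) (x : R) : Prop :=
  if unpickle n is Some (t, c, c') then
    [/\ mu (A (ratr t) (ratr c')) = 0 -> ~ A (ratr t) (ratr c') x &
        mu (B (ratr t) (ratr c)) = 0 -> ~ B (ratr t) (ratr c) x] : Prop
  else True.
have Pae n : {ae mu, forall x, Pn n x}.
  rewrite /Pn; case: (unpickle n) => [[[t c] c']|]; last exact: aeW.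
  have null_ae (C : set R) : measurable C -> {ae mu, forall x, mu C = 0 -> ~ C x}.
    move=> mC; have [C0|C0] := pselect (mu C = 0); last exact: aeW.
    by exists C; split => // x /= /not_implyP[_ /contrapT].
  apply: negligibleS (negligibleU (null_ae _ (mA _ _)) (null_ae _ (mB _ _))).
  move=> x /= nAB; apply: contrapT => /not_orP[/contrapT nA /contrapT nB].
  by apply: nAB; split; [exact: nA|exact: nB].
have [Z [mZ Z0 PZ]] := ae_foralln Pae.
exists Z; split => // x y x0 xy yD Zx Zy.
have good z : ~ Z z -> forall n, Pn n z.
  by move=> Zz; apply: contrapT => nP; apply: Zz; exact: PZ.
rewrite leNgt; apply/negP => Gyx.
have [t] := rat_in_itvoo xy; rewrite in_itv/= => /andP[xt ty].
have [c] := rat_in_itvoo Gyx; rewrite in_itv/= => /andP[Gyc cGx].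
have [c'] := rat_in_itvoo cGx; rewrite in_itv/= => /andP[cc' c'Gx].
have Ax : A (ratr t) (ratr c') x.
  split; [split|]; rewrite /= in_itv/=.
  - by rewrite (ltW x0) (ltW (lt_trans xy yD)).
  - by rewrite andbT ltW.
  - by rewrite (ltW x0) (ltW xt).
have By : B (ratr t) (ratr c) y.
  split; [split|]; rewrite /= in_itv/=.
  - by rewrite (ltW (lt_trans x0 xy)) (ltW yD).
  - by rewrite ltW.
  - by rewrite ty (ltW yD).
have Gx := good x Zx (pickle (t, c, c')); rewrite /Pn pickleK in Gx.
have Gy := good y Zy (pickle (t, c, c')); rewrite /Pn pickleK in Gy.
case: Gx => Ax0 _; case: Gy => _ By0.
apply: (@postpone_false _ D a b Te Tc N s E P D0 a0 b0 sP oP (ratr t) (ratr c)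
  (ratr c') (B (ratr t) (ratr c)) (A (ratr t) (ratr c'))) => //.
- by rewrite (ltW (lt_trans x0 xt)) (ltW (lt_trans ty yD)).
- by move=> z [].
- by move=> z [].
- by move=> z [[_ /=]]; rewrite in_itv.
- by move=> z [[_ /=]]; rewrite in_itv/= andbT.
- by rewrite lt0e measure_ge0 andbT; apply/eqP => /By0.
- by rewrite lt0e measure_ge0 andbT; apply/eqP => /Ax0.
Qed.

(** [H] is the infimum of [G] over the good points to the right; it is monotone everywhere and
    agrees with [G] at good points. The behaviour at [D] is conditional because [H] could a priori
    blow up there; [bounded_left] excludes this. *)
Lemma monotone_version : exists H : R -> R, [/\
  version D P (fun t => expR (- (b * t)) * H t - 1),
  {in `[0, D[ &, nondecreasing_fun H},
  H x @[x --> 0^'+] --> H 0 &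
  has_ubound (H @` `[0, D[) -> H x @[x --> D^'-] --> H D].
Proof.
have [Z [mZ Z0 Gmono]] := exchange_monotone_ae.
have [[mP P0] _ _ _] := fP.
pose S : set R := `]0, D[ `\` Z.
have S_itv x : S x -> 0 < x < D by move=> [/=]; rewrite in_itv.
(* A nondegenerate interval is not contained in a null set, so [S] is dense. *)
have S_meets u v : 0 <= u -> u < v -> v <= D -> exists2 x, S x & u < x < v.
  move=> u0 uv vD; apply: contrapT => nS.
  have sub : `]u, v[ `<=` Z.
    move=> x /=; rewrite in_itv/= => /andP[ux xv]; apply: contrapT => Zx.
    apply: nS; exists x; last by rewrite ux.
    by split => //=; rewrite in_itv/= (le_lt_trans u0 ux) (lt_le_trans xv vD).
  have : (mu (`]u, v[ : set R) <= mu Z)%E by apply: le_measure; rewrite ?inE.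
  rewrite Z0 lebesgue_measure_itv/= lte_fin uv -EFinD lee_fin.
  by rewrite leNgt subr_gt0 uv.
have SG x : S x -> expR (b * x) <= G x.
  move=> /S_itv/andP[/ltW x0 /ltW xD]; rewrite ler_peMr ?expR_ge0// lerDl.
  by apply: P0; rewrite in_itv/= x0.
pose A t : set R := [set G x | x in S `&` [set x | t <= x]].
pose H0 t := inf (A t).
have A_lb t : lbound (A t) (expR (b * t)).
  move=> _ [x [Sx /= tx] <-]; apply: le_trans (SG _ Sx).
  by rewrite ler_expR ler_pM2l.
have A_hlb t : has_lbound (A t) by exists (expR (b * t)); exact: A_lb.
have A_n0 t : 0 <= t < D -> A t !=set0.
  move=> /andP[t0 tD]; have [x Sx /andP[tx xD]] := S_meets _ _ t0 tD (lexx D).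
  by exists (G x), x => //; split => //=; exact: ltW.
have H0_le t x : S x -> t <= x -> H0 t <= G x.
  by move=> Sx tx; apply: ge_inf => //; exists x.
have H0_ge t y : 0 <= t < D -> lbound (A t) y -> y <= H0 t.
  by move=> tD; apply: lb_le_inf; exact: A_n0.
have H0S x : S x -> H0 x = G x.
  move=> Sx; have /andP[x0 xD] := S_itv _ Sx.
  apply/eqP; rewrite eq_le H0_le//= H0_ge ?(ltW x0)//.
  move=> _ [y [Sy /= xley] <-].
  have [->//|xy] : x = y \/ x < y by apply/predU1P; rewrite -le_eqVlt.
  by have /andP[_ yD] := S_itv _ Sy; apply: Gmono => //; [case: Sx|case: Sy].
have H0_nd : {in `[0, D[ &, nondecreasing_fun H0}.
  move=> x y _; rewrite in_itv/= => yD xy; apply: H0_ge => // _ [z [Sz /= yz] <-].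
  by apply: H0_le => //; exact: le_trans yz.
have H0_exp t : 0 <= t < D -> expR (b * t) <= H0 t.
  by move=> tD; apply: H0_ge.
(* At [D] the left limit is the value wanted. If it does not exist, [lim] is a default value, and
   the maximum with e^{bD} still keeps the policy nonnegative. *)
pose H t := if t < D then H0 t else Num.max (expR (b * D)) (lim (H0 y @[y --> D^'-])).
have HE t : t < D -> H t = H0 t by rewrite /H => ->.
exists H; split.
- split; [split|].
  + rewrite -(@setUitv1 _ _ (BLeft 0) D true)//; last by rewrite bnd_simp ltW.
    apply/measurable_funU => //; split; last exact: measurable_fun_set1.
    apply: (@eq_measurable_fun _ _ _ _ _ (fun t => expR (- (b * t)) * H0 t - 1)).
      by move=> x; rewrite inE/= in_itv/= => /andP[_ xD]; rewrite HE.
    apply: measurable_funB => //; apply: measurable_funM; last first.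
      exact: nondecreasing_in_measurable.
    apply: measurable_funTS; apply: continuous_measurable_fun.
    exact: continuous_expN.
  + move=> t; rewrite in_itv/= => /andP[t0]; rewrite le_eqVlt => tD.
    rewrite subr_ge0 expRN mulrC ler_pdivlMr ?expR_gt0// mul1r.
    case/predU1P: tD => [->|tD]; first by rewrite /H ltxx le_max lexx.
    by rewrite HE// H0_exp// t0.
  + have null1 (z : R) : mu.-negligible [set z].
      by exists [set z]; split => //; exact: lebesgue_measure_set1.
    have nullZ : mu.-negligible Z by exists Z; split.
    apply: negligibleS (negligibleU nullZ (negligibleU (null1 0) (null1 D))).
    move=> x /= /not_implyP[]; rewrite in_itv/= => /andP[x0 xD] neq.
    have [Zx|Zx] := pselect (Z x); [by left|right].
    move: x0 xD; rewrite !le_eqVlt => /predU1P[<-|x0]; first by left.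
    move=> /predU1P[->|xD]; first by right.
    case: neq; rewrite HE// H0S; last by split => //=; rewrite in_itv/= x0.
    by rewrite /G mulrA -expRD addNr expR0 mul1r addrAC subrr add0r.
- move=> x y xD yD xy; move: (xD) (yD); rewrite !in_itv/=.
  by move=> /andP[_ xltD] /andP[_ yltD]; rewrite !HE// H0_nd.
- apply/cvgrPdist_le => e e0.
  have H00 : 0 <= (0 : R) < D by rewrite lexx.
  have hi : has_inf (A 0) by split; [exact: A_n0|].
  have [_ [y [Sy _] <-] Gy] := inf_adherent e0 hi.
  (* The near-minimiser [y] is positive, so [H0] stays below [G y] on the whole of ]0, y[. *)
  have /andP[y0 yD] := S_itv _ Sy.
  near=> x.
  have x0 : 0 < x by near: x; exact: nbhs_right_gt.
  have xy : x < y by near: x; exact: nbhs_right_lt.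
  have xD := lt_trans xy yD.
  rewrite !HE// distrC ger0_norm; last first.
    by rewrite subr_ge0 H0_nd ?in_itv/= ?lexx ?D0 ?(ltW x0).
  rewrite lerBlDl; apply: le_trans (ltW Gy); apply: H0_le => //.
  exact: ltW.
- move=> [M HM].
  have cH0 : cvg (H0 y @[y --> D^'-]).
    apply: nondecreasing_at_left_is_cvgr; near=> x.
      have x0 : 0 < x by near: x; exact: nbhs_left_gt.
      move=> y z; rewrite !in_itv/= => /andP[xy yD] /andP[xz zD].
      by apply: H0_nd; rewrite in_itv/= ?yD ?zD andbT ltW// (lt_trans x0).
    have x0 : 0 < x by near: x; exact: nbhs_left_gt.
    exists M => _ [y /= + <-]; rewrite in_itv/= => /andP[xy yD].
    by apply: HM; exists y; rewrite ?HE//= in_itv/= yD andbT ltW// (lt_trans x0).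
  have lim_ge : expR (b * D) <= lim (H0 y @[y --> D^'-]).
    have ce : expR (b * y) @[y --> D^'-] --> expR (b * D).
      apply: cvg_at_left_filter; apply: continuous_comp; last exact: continuous_expR.
      by apply: cvgMr; exact: cvg_id.
    rewrite -(cvg_lim _ ce)//; apply: ler_lim => //; first by apply/cvg_ex; eexists; exact: ce.
    near=> y; apply: H0_exp; apply/andP; split; last by near: y; exact: nbhs_left_lt.
    by near: y; exact: nbhs_left_ge.
  (* The limit is at least e^{bD}, so the maximum in the definition of [H] is the limit itself. *)
  rewrite {2}/H ltxx max_r//.
  apply: cvg_trans cH0; apply: near_eq_cvg; near=> y.
  by rewrite HE//; near: y; exact: nbhs_left_lt.
Unshelve. all: by end_near. Qed.

End MonotoneVersion.

(** * Invariance under change of version, and location of the discontinuities *)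

Section Jumps.
Context {R : realType}.
Local Notation mu := (@lebesgue_measure R).

Section Version.
Variables (D : R) (P Q : R -> R).
Hypotheses (mP : measurable_fun `[0, D] P) (PQ : version D P Q).

(** The integrand is left general so as to cover consumption, temperature and throughput at once. *)
Lemma version_integral (t : R) (F : R -> R -> R) : t <= D ->
  (forall f, measurable_fun `[0, D] f ->
     measurable_fun `[0, D] (fun x => F x (f x))) ->
  (\int[mu]_(x in `[0%R, t]) (F x (Q x))%:E =
   \int[mu]_(x in `[0%R, t]) (F x (P x))%:E)%E.
Proof.
move=> tD mF; have [[mQ _] QP] := PQ.
have sub : `[0, t] `<=` (`[0, D] : set R) by exact: sub_itv0.
apply: ae_eq_integral => //.
- by apply/measurable_EFinP; apply: measurable_funS sub _ => //; exact: mF.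
- by apply/measurable_EFinP; apply: measurable_funS sub _ => //; exact: mF.
- apply: negligibleS QP => x /= nF QP; apply: nF => /sub xD.
  by rewrite QP.
Qed.

Lemma version_consumed t : t <= D -> consumed Q t = consumed P t.
Proof. by move=> tD; exact: (@version_integral t (fun=> id)). Qed.

Lemma version_temperature a b Te t : t <= D ->
  temperature a b Te Q t = temperature a b Te P t.
Proof.
move=> tD; rewrite /temperature; congr (_ + _ * _)%E.
apply: (@version_integral t (fun x y => a * expR (b * x) * y)) => // f mf.
apply: measurable_funM => //; apply: measurable_funTS.
by apply: continuous_measurable_fun; exact: continuous_expM.
Qed.

Lemma version_throughput : throughput D Q = throughput D P.
Proof.
apply: (@version_integral D (fun _ y => 2^-1 * (ln (1 + y) / ln 2))) => //.
exact: measurable_rate.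
Qed.

Lemma version_optimal a b Te Tc N s E :
  optimal D a b Te Tc N s E P -> optimal D a b Te Tc N s E Q.
Proof.
move=> [[pP tP cP] oP]; split=> [|P' fP']; last by rewrite version_throughput oP.
split; first exact: PQ.1.
- move=> t tD; rewrite version_temperature ?tP//.
  by move: tD; rewrite in_itv => /andP[].
- move=> t tD; rewrite version_consumed ?cP//.
  by move: tD; rewrite in_itv => /andP[].
Qed.

End Version.

Lemma mu_itv_gt0 (b0 b1 : bool) (u v : R) : u < v ->
  (0 < mu ([set` Interval (BSide b0 u) (BSide b1 v)] : set R))%E.
Proof.
by move=> uv; rewrite lebesgue_measure_itv/= lte_fin uv -EFinB lte_fin subr_gt0.
Qed.

(** Here [left] names the endpoint of [[0, D]]; relative to the interval, that endpoint is
    approached from the right only. *)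
Lemma cvg_within_left (D : R) (f : R -> R) : 0 < D ->
  f x @[x --> 0^'+] --> f 0 ->
  f x @[x --> within `[0, D] (nbhs 0)] --> f 0.
Proof.
move=> D0 cf V Vf.
have V_side : \forall x \near (0 : R), 0 < x -> V (f x) := cf _ Vf.
suff : \forall x \near (0 : R), `[0, D]%classic x -> V (f x) by [].
apply: filterS V_side => x Vx /=; rewrite in_itv/= => /andP[].
rewrite le_eqVlt => /predU1P[<- _|x0 _].
  exact: nbhs_singleton Vf.
exact: Vx.
Qed.

Lemma cvg_within_right (D : R) (f : R -> R) : 0 < D ->
  f x @[x --> D^'-] --> f D ->
  f x @[x --> within `[0, D] (nbhs D)] --> f D.
Proof.
move=> D0 cf V Vf.
have V_side : \forall x \near (D : R), x < D -> V (f x) := cf _ Vf.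
suff : \forall x \near (D : R), `[0, D]%classic x -> V (f x) by [].
apply: filterS V_side => x Vx /=; rewrite in_itv/= => /andP[_].
rewrite le_eqVlt => /predU1P[->|x0].
  exact: nbhs_singleton Vf.
exact: Vx.
Qed.

(** Monotonicity provides one-sided limits with [l <= H t <= r]; equality of the limits is
    continuity, and otherwise they bound a gap. *)
Lemma nondecreasing_gap (D t : R) (H : R -> R) :
  {in `[0, D[ &, nondecreasing_fun H} -> 0 < t < D ->
  {for t, continuous H} \/ exists l r, [/\ l < r,
    forall x, 0 <= x < t -> H x <= l & forall x, t < x < D -> r <= H x].
Proof.
move=> ndH /andP[t0 tD].
have tin : t \in `[0, D[ by rewrite in_itv/= tD ltW.
have cl : cvg (H x @[x --> t^'-]).
  apply: nondecreasing_at_left_is_cvgr; near=> x.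
    have x0 : 0 < x by near: x; exact: nbhs_left_gt.
    move=> y z; rewrite !in_itv/= => /andP[xy yt] /andP[xz zt].
    by apply: ndH; rewrite in_itv/= ltW ?(lt_trans x0)// (lt_trans _ tD).
  have x0 : 0 < x by near: x; exact: nbhs_left_gt.
  exists (H t) => _ [y /= + <-]; rewrite in_itv/= => /andP[xy yt].
  by apply: ndH (ltW yt); rewrite in_itv/= ltW ?(lt_trans x0)// (lt_trans yt).
have cr : cvg (H x @[x --> t^'+]).
  apply: nondecreasing_at_right_is_cvgr; near=> x.
    have xD : x < D by near: x; exact: nbhs_right_lt.
    move=> y z; rewrite !in_itv/= => /andP[ty yx] /andP[tz zx].
    by apply: ndH; rewrite in_itv/= ltW ?(lt_trans t0)// (lt_trans _ xD).
  have xD : x < D by near: x; exact: nbhs_right_lt.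
  exists (H t) => _ [y /= + <-]; rewrite in_itv/= => /andP[ty yx].
  apply: ndH (ltW ty) => //.
  by rewrite in_itv/= (lt_trans yx xD) ltW ?(lt_trans t0).
set l := lim (H x @[x --> t^'-]) in cl; set r := lim (H x @[x --> t^'+]) in cr.
have Hl x : 0 <= x < t -> H x <= l.
  move=> /andP[x0 xt]; apply: limr_ge => //; near=> y.
  have xy : x < y by near: y; exact: nbhs_left_gt.
  have yt : y < t by near: y; exact: nbhs_left_lt.
  apply: ndH (ltW xy); rewrite in_itv/=; first by rewrite x0 (lt_trans xt).
  by rewrite (lt_trans yt tD) ltW// (le_lt_trans x0).
have Hr x : t < x < D -> r <= H x.
  move=> /andP[tx xD]; apply: limr_le => //; near=> y.
  have yx : y < x by near: y; exact: nbhs_right_lt.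
  have ty : t < y by near: y; exact: nbhs_right_gt.
  apply: ndH (ltW yx); rewrite in_itv/=; last by rewrite xD ltW ?(lt_trans t0).
  by rewrite (lt_trans yx xD) ltW// (lt_trans t0).
have lH : l <= H t.
  apply: limr_le => //; near=> y.
  have yt : y < t by near: y; exact: nbhs_left_lt.
  have y0 : 0 < y by near: y; exact: nbhs_left_gt.
  by apply: ndH (ltW yt) => //; rewrite in_itv/= (lt_trans yt tD) ltW.
have Hrt : H t <= r.
  apply: limr_ge => //; near=> y.
  have ty : t < y by near: y; exact: nbhs_right_gt.
  have yD : y < D by near: y; exact: nbhs_right_lt.
  by apply: ndH (ltW ty) => //; rewrite in_itv/= yD ltW ?(lt_trans t0).
have [lr|rl] := ltP l r; first by right; exists l, r.
left; have lE : l = H t by apply/eqP; rewrite eq_le lH (le_trans Hrt).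
have rE : r = H t by apply/eqP; rewrite eq_le Hrt (le_trans rl).
apply/left_right_continuousP; split.
  by rewrite -lE.
by rewrite -rE.
Unshelve. all: by end_near. Qed.

(** * Boundedness near the deadline and discontinuities inside the horizon *)

Section Main.
Variables (D a b Te Tc : R) (N : nat) (s E : nat -> R) (H : R -> R).
Let Q x := expR (- (b * x)) * H x - 1.
Hypotheses (D0 : 0 < D) (a0 : 0 < a) (b0 : 0 < b) (Te_Tc : Te < Tc).
Hypothesis (sP : arrival_times D N s).
Hypothesis oQ : optimal D a b Te Tc N s E Q.
Hypothesis ndH : {in `[0, D[ &, nondecreasing_fun H}.

Let fQ : real_feasible D a b Te Tc N s E Q.
Proof. by apply/feasibleP => //; exact: oQ.1. Qed.

Let Q0 x : 0 <= x <= D -> 0 <= Q x.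
Proof. by move=> xD; have [[_ +] _ _ _] := fQ; apply; rewrite in_itv. Qed.

Let H_ge0 x : 0 <= x <= D -> 0 <= H x.
Proof.
move=> /Q0; rewrite /Q subr_ge0 => /(le_trans ler01).
by rewrite pmulr_rge0// expR_gt0.
Qed.

Let Q_ge M x : 0 <= x <= D -> expR (b * D) * (1 + M) <= H x -> M <= Q x.
Proof.
move=> /andP[x0 xD] MH; have Hx : 0 <= H x by apply: H_ge0; rewrite x0.
rewrite /Q lerBrDl; apply: (@le_trans _ _ (expR (- (b * D)) * H x)).
  by rewrite expRN mulrC ler_pdivlMr ?expR_gt0// mulrC.
by rewrite ler_wpM2r// ler_expR lerN2 ler_pM2l.
Qed.

Let Q_le x : 0 <= x <= D -> Q x <= H x.
Proof.
move=> xD; have Hx := H_ge0 xD; rewrite /Q lerBlDl.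
apply: (@le_trans _ _ (H x)); last by rewrite lerDr.
rewrite ler_piMl// -expR0 ler_expR oppr_le0 mulr_ge0 ?(ltW b0)//.
by case/andP: xD.
Qed.

(** Contact at [t] followed by power at least [q], too large to stay on the critical curve, would
    violate the temperature bound at [D]. *)
Let contact_high (t q : R) : 0 <= t < D -> (forall x, t < x < D -> q <= Q x) ->
  Tc - Te < a * q / b -> heat a b Q t < (Tc - Te) * expR (b * t).
Proof.
move=> /andP[t0 tD] qQ Tq; have [_ iQ hQ _] := fQ.
rewrite lt_neqAle hQ ?t0 ?ltW// andbT; apply/eqP => ht.
have hD : heat a b Q D <= (Tc - Te) * expR (b * D) by apply: hQ; rewrite lexx ltW.
have tDD : t < D <= D by rewrite tD lexx.
by have := contact_right a0 b0 iQ t0 tDD ht hD qQ; rewrite leNgt Tq.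
Qed.

(** If [H] blew up at [D], the power would eventually stay above the level sustainable at [Tc]; the
    temperature would then be strictly below [Tc] near [D], after all arrivals, and advancing power
    from closer to [D] would be profitable. *)
Lemma bounded_left : has_ubound (H @` `[0, D[).
Proof.
apply: contrapT => nub.
have [_ iQ hQ eQ] := fQ; have [s0 sD _] := sP.
have big M : exists2 x, 0 <= x < D & M < H x.
  apply: contrapT => nM; apply: nub; exists M => _ [x /= + <-].
  rewrite in_itv/= => xD; rewrite leNgt; apply/negP => MH.
  by apply: nM; exists x.
have sN : s N < D by rewrite -sD (arrival_ltW sP)// ltnSn.
(* The constant power that keeps the temperature at [Tc]. *)
pose K := (Tc - Te) * b / a.
have K0 : 0 < K by rewrite divr_gt0// mulr_gt0// subr_gt0.
have [y /andP[y0 yD] Hy] := big (expR (b * D) * (1 + (K + 1))).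
(* Beyond [y'] the power is large and no arrival remains before [D]. *)
pose y' := Num.max y (s N).
have y'D : y' < D by rewrite gt_max yD.
pose u := (y' + D) / 2.
have y'u : y' < u by rewrite /u; lra.
have uD : u < D by rewrite /u; lra.
have yu : y < u by apply: le_lt_trans y'u; rewrite le_max lexx.
have sNu : s N < u by apply: le_lt_trans y'u; rewrite le_max lexx orbT.
have u0 : 0 <= u by rewrite ltW// (le_lt_trans y0).
have Qbig x : u <= x < D -> K + 1 <= Q x.
  move=> /andP[ux xD]; have x0 := le_trans u0 ux.
  apply: Q_ge; first by rewrite x0 ltW.
  apply: le_trans (ltW Hy) _; apply: ndH.
  - by rewrite in_itv/= y0.
  - by rewrite in_itv/= x0.
  - by rewrite (le_trans _ ux)// ltW.
have hlt t : u <= t < D -> heat a b Q t < (Tc - Te) * expR (b * t).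
  move=> /andP[ut tD]; apply: (@contact_high t (K + 1)).
  - by rewrite (le_trans u0 ut).
  - by move=> x /andP[tx xD]; apply: Qbig; rewrite xD (le_trans ut)// ltW.
  - have -> : a * (K + 1) / b = Tc - Te + a / b.
      by rewrite /K; field; rewrite !gt_eqF.
    by rewrite ltrDl divr_gt0.
pose m := (u + D) / 2.
have um : u < m by rewrite /m; lra.
have mD : m < D by rewrite /m; lra.
have m0 : 0 <= m by rewrite ltW// (le_lt_trans u0).
pose p := H m.
have p0 : 0 <= p by apply: H_ge0; rewrite m0 ltW.
have [z /andP[z0 zD] Hz] := big (expR (b * D) * (1 + (p + 1))).
pose z' := Num.max z m.
have z'D : z' < D by rewrite gt_max zD.
(* The window must end before [D]: the strict temperature bound is known only for times below [D],
   and [s N.+1 = D] must lie outside. *)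
pose v := (z' + D) / 2.
have z'v : z' < v by rewrite /v; lra.
have vD : v < D by rewrite /v; lra.
have mz' : m <= z' by rewrite le_max lexx orbT.
have zz' : z <= z' by rewrite le_max lexx.
apply: (@advance_false _ D a b Te Tc N s E Q D0 a0 b0 sP oQ u m v p (p + 1)
  `[u, m] `]z', v]) => //.
- by rewrite u0 ltW.
- by rewrite (le_trans mz' (ltW z'v)) ltW.
- by rewrite p0/= ltrDl ltr01.
- by move=> x /=; rewrite !in_itv/= => /andP[/(le_lt_trans mz')->].
- move=> x /=; rewrite in_itv/= => /andP[ux xm].
  have x0 := le_trans u0 ux; have xD := le_lt_trans xm mD.
  apply: le_trans (Q_le _) _; first by rewrite x0 ltW.
  by apply: ndH xm; rewrite in_itv/= ?x0 ?m0.
- move=> x /=; rewrite in_itv/= => /andP[z'x xv].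
  have zx := le_lt_trans zz' z'x; have x0 := le_lt_trans z0 zx.
  have xD := le_lt_trans xv vD.
  apply: Q_ge; first by rewrite !ltW.
  by apply: le_trans (ltW Hz) _; apply: ndH (ltW zx); rewrite in_itv/= ?z0 ?zD ?xD ?ltW.
- by move=> t /andP[ut tv]; apply: hlt; rewrite ut (le_lt_trans tv).
- move=> k kN /andP[us sv]; exfalso.
  have : s k.+1 < s N.+1 by rewrite sD (lt_trans sv).
  have [kltN _|Nk] := ltnP k N.
    have := lt_le_trans sNu us; rewrite ltNge (arrival_le sP)//.
    by rewrite kltN leqnSn.
  have -> : k = N by apply/eqP; rewrite eqn_leq kN.
  by rewrite ltxx.
- exact: mu_itv_gt0.
- exact: mu_itv_gt0.
Qed.

(** A discontinuity is an upward gap of [H], hence of [Q]. If the battery is nonempty at [t], or [t]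
    is no arrival, [advance_false] applies to a small window around [t]; contact with [Tc] at [t] is
    excluded separately by the heat balance. *)
Lemma interior_jump t : 0 < t < D ->
  {for t, continuous Q} \/ exists k, [/\ (1 <= k <= N)%N, t = s k,
    energy Q (s k) = \sum_(i < k) E i &
    heat a b Q (s k) < (Tc - Te) * expR (b * s k)].
Proof.
move=> t0D; have /andP[t0 tD] := t0D; have [_ iQ hQ eQ] := fQ.
have ce := @continuous_expN R b.
have [cH|[l [r [lr Hl Hr]]]] := nondecreasing_gap ndH t0D.
  left; apply: cvgB; last exact: cvg_cst.
  by apply: cvgM; [exact: ce|exact: cH].
right; apply: contrapT => nex.
pose p0 := expR (- (b * t)) * l - 1; pose q0 := expR (- (b * t)) * r - 1.
have pq0 : p0 < q0 by rewrite ltrD2r ltr_pM2l// expR_gt0.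
(* Moving inward by a third of the gap leaves [p < q] and absorbs the variation of e^{-bx} near
   [t]. *)
pose p := p0 + (q0 - p0) / 3; pose q := q0 - (q0 - p0) / 3.
have pq : p < q by rewrite /p /q; lra.
have near_p : \forall x \near t, expR (- (b * x)) * l - 1 < p.
  have cl : expR (- (b * x)) * l - 1 @[x --> t] --> p0.
    by apply: cvgB; [apply: cvgMl; exact: ce|exact: cvg_cst].
  by apply: (cvgr_lt _ cl); rewrite /p; lra.
have near_q : \forall x \near t, q < expR (- (b * x)) * r - 1.
  have cr : expR (- (b * x)) * r - 1 @[x --> t] --> q0.
    by apply: cvgB; [apply: cvgMl; exact: ce|exact: cvg_cst].
  by apply: (cvgr_gt _ cr); rewrite /q; lra.
have near_D : \forall x \near t, 0 < x < D.
  have t_in : t \in `]0, D[ by rewrite in_itv.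
  by have := near_in_itvoo t_in; apply: filterS => x; rewrite in_itv.
pose slack x := heat a b Q x < (Tc - Te) * expR (b * x).
have near_slack : \forall x \near t, slack t -> slack x.
  have [st|st] := pselect (slack t); last by near=> x => /st.
  have ch : {for t, continuous (fun x => (Tc - Te) * expR (b * x) - heat a b Q x)}.
    apply: cvgB; first exact: continuous_expM.
    have /(continuous_within_itvP _ D0)[ch _ _] := @heat_continuous R D a b Q iQ D0.
    by apply: ch; rewrite in_itv.
  have slack0 : 0 < (Tc - Te) * expR (b * t) - heat a b Q t by rewrite subr_gt0.
  have near_pos := cvgr_gt _ ch _ slack0; near=> x => _.
  rewrite /slack -subr_gt0; near: x; exact: near_pos.
(* Within distance [d0] of [t] there is no arrival instant other than possibly [t]. *)
have [k kN /eqP skt|d0 d0_gt0 sd0] := @finite_margin R (fun k => `|t - s k.+1|)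
    (fun k => s k.+1 <> t) N.
  by rewrite normr_gt0 subr_eq0 eq_sym.
have [d d_gt0 dP] : exists2 d, 0 < d & forall x, `|t - x| < d ->
    [/\ expR (- (b * x)) * l - 1 < p, q < expR (- (b * x)) * r - 1,
        0 < x < D, slack t -> slack x & `|t - x| < d0].
  have near_d0 : \forall x \near t, `|t - x| < d0.
    by apply: (@nbhsx_ballx _ _ t d0).
  have : \forall x \near t,
      [/\ expR (- (b * x)) * l - 1 < p, q < expR (- (b * x)) * r - 1,
          0 < x < D, slack t -> slack x & `|t - x| < d0].
    by near=> x; split; near: x.
  by move=> /nbhs_ballP[d /= d_gt0 dP]; exists d.
pose u := t - d / 2; pose v := t + d / 2.
have ut : u < t by rewrite /u; lra.
have tv : t < v by rewrite /v; lra.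
have uvP x : u <= x <= v ->
    [/\ expR (- (b * x)) * l - 1 < p, q < expR (- (b * x)) * r - 1,
        0 < x < D, slack t -> slack x & `|t - x| < d0].
  move=> /andP[]; rewrite /u /v => ux xv; apply: dP.
  by rewrite ltr_norml; apply/andP; split; lra.
have QP x : u <= x < t -> Q x <= p.
  move=> /andP[ux xt]; have [|xp _ /andP[x0 _] _ _] := uvP x.
    by rewrite ux ltW// (lt_trans xt).
  apply: le_trans (ltW xp); rewrite lerD2r ler_wpM2l ?expR_ge0// Hl//.
  by rewrite (ltW x0).
have Qq x : t < x <= v -> q <= Q x.
  move=> /andP[tx xv]; have [|_ qx /andP[_ xD] _ _] := uvP x.
    by rewrite xv ltW// (lt_trans ut).
  apply: le_trans (ltW qx) _; rewrite lerD2r ler_wpM2l ?expR_ge0// Hr//.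
  by rewrite tx.
have [|_ _ /andP[u0 uD] _ _] := uvP u; first by rewrite lexx ltW// (lt_trans ut).
have [|_ _ /andP[v0 vD] _ _] := uvP v; first by rewrite lexx ltW// (lt_trans ut).
have p_ge0 : 0 <= p.
  apply: le_trans (Q0 _) (QP u _); last by rewrite lexx.
  by rewrite !ltW.
(* At contact the left side would require [Tc - Te <= a * p / b] and the right side
   [a * q / b <= Tc - Te], against [p < q]. *)
have st : slack t.
  rewrite /slack lt_neqAle hQ ?ltW// andbT; apply/eqP => ht.
  have k_le : Tc - Te <= a * p / b.
    apply: (contact_left a0 b0 iQ (ltW u0) _ ht (hQ u _)).
    - by rewrite ut ltW.
    - by rewrite !ltW.
    - by move=> x /andP[ux xt]; apply: QP; rewrite xt ltW.
  have k_ge : a * q / b <= Tc - Te.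
    apply: (contact_right a0 b0 iQ (ltW t0) _ ht (hQ v _)).
    - by rewrite tv ltW.
    - by rewrite !ltW.
    - by move=> x /andP[tx xv]; apply: Qq; rewrite tx ltW.
  have := le_trans k_ge k_le; rewrite ler_pM2r ?invr_gt0// ler_pM2l//.
  by rewrite leNgt pq.
apply: (@advance_false _ D a b Te Tc N s E Q D0 a0 b0 sP oQ u t v p q
  `[u, t[ `]t, v]) => //.
- by rewrite !ltW.
- by rewrite !ltW.
- by rewrite p_ge0.
- exact: subset_itv_co_cc.
- by move=> x /uvP[_ _ _ + _]; exact.
(* By the choice of [d0] an arrival in the window is [t] itself. An empty battery there would be the
   excluded alternative, with index at most [N] because [t < D]. *)
- move=> k kN /andP[us sv]; rewrite lt_neqAle eQ// andbT; apply/eqP => ek.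
  have skt : s k.+1 = t.
    apply: contrapT => nskt; have := sd0 _ kN nskt.
    have [|_ _ _ _] := uvP (s k.+1); first by rewrite us ltW.
    by move=> /lt_le_trans/[apply]; rewrite ltxx.
  apply: nex; exists k.+1; rewrite skt; split => //; last by rewrite -[in LHS]skt.
  rewrite /= ltnNge; apply/negP => Nk.
  have kE : k = N by apply/eqP; rewrite eqn_leq kN.
  have [_ sD _] := sP.
  by move: tD; rewrite -skt kE sD ltxx.
- exact: mu_itv_gt0.
- exact: mu_itv_gt0.
Unshelve. all: by end_near. Qed.

End Main.

End Jumps.

(** * The endpoints of the horizon and the return to the original policy *)

Unset Implicit Arguments.
Set Strict Implicit.

Theorem lemma11 (R : realType) (D a b Te Tc : R) (N : nat) (s E : nat -> R)
    (P : R -> R)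
    (D_gt0 : 0 < D) (a_gt0 : 0 < a) (b_gt0 : 0 < b) (Te_lt_Tc : Te < Tc)
    (s_arrival : arrival_times D N s)
    (E_gt0 : forall k : nat, (k <= N)%N -> 0 < E k)
    (P_opt : optimal D a b Te Tc N s E P) :
  exists Q : R -> R, version D P Q /\
    forall t : R, jump_at D Q t ->
      exists k : nat,
        [/\ (1 <= k <= N)%N, t = s k,
            consumed P (s k) = (\sum_(i < k) E i)%:E
          & (temperature a b Te P (s k) < Tc%:E)%E].
Proof.
have [H [PQ ndH H_0 H_D]] := monotone_version D_gt0 a_gt0 b_gt0 s_arrival P_opt.
have mP : measurable_fun `[0, D] P by case: P_opt => -[[]].
have Q_opt := version_optimal mP PQ P_opt.
have [_ iQ _ _] := (feasibleP a b Te Tc E _ D_gt0 s_arrival).1 Q_opt.1.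
set Q := (fun t => _) in PQ Q_opt iQ.
(* The exponential factor is continuous, so one-sided continuity passes from [H] to [Q]. *)
have cvgQ (F : set_system R) x : Filter F -> F --> x ->
    H y @[y --> F] --> H x -> Q y @[y --> F] --> Q x.
  move=> FF Fx HF; apply: cvgB; last exact: cvg_cst.
  by apply: cvgM HF; apply: cvg_comp Fx (@continuous_expN R b x).
exists Q; split=> // t [].
rewrite in_itv/= => /andP[]; rewrite le_eqVlt => /predU1P[<- _|t0].
  case; apply: cvg_within_left => //; apply: cvgQ H_0.
  exact: cvg_at_right_filter cvg_id.
rewrite le_eqVlt => /predU1P[->|tD].
  case; apply: cvg_within_right => //; apply: cvgQ.
    exact: cvg_at_left_filter cvg_id.
  apply: H_D.
  exact: (bounded_left D_gt0 a_gt0 b_gt0 Te_lt_Tc s_arrival Q_opt ndH).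
have t0D : 0 < t < D by rewrite t0.
have [cQ []|[k [kN tE ek hk]] _] :=
  interior_jump D_gt0 a_gt0 b_gt0 s_arrival Q_opt ndH t0D.
  exact: cvg_within_filter cQ.
have skD : s k <= D by rewrite -tE ltW.
(* Energy and temperature are integrals, so they take the same values for [P] and for its version
   [Q]. *)
exists k; split => //.
  by rewrite -(version_consumed mP PQ)// (consumedE iQ)// ek.
by rewrite -(version_temperature mP PQ)// (temperatureE _ _ _ iQ)// lte_fin temp_ltE.
Qed.
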